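(* Let $\Omega\subset\mathbb{R}^2$ be open, $\lambda>0$, and let $u\in L^2(\Omega)$ satisfy $-\Delta u=\lambda u$ in $\Omega$. Let $\mathbf{x}_0\in\Omega$, $h>0$, $\alpha\in(0,1)$, and let $\mathbf{e}^-,\mathbf{e}^+$ be unit vectors with angle $\alpha\pi$ from $\mathbf{e}^-$ to $\mathbf{e}^+$; put $\Gamma^\pm=\{\mathbf{x}_0+t\mathbf{e}^\pm:0\le t\le h\}\subset\Omega$. Suppose $\partial_\nu u=0$ on $\Gamma^+$ and on $\Gamma^-$ (both are singular lines; $\nu$ a unit normal to the respective segment). Let $n\in\mathbb{N}$, $n\ge3$. If $u(\mathbf{x}_0)=0$ and $\alpha\neq q/p$ for all integers $1\le q<p\le n-1$, then $u$ vanishes up to the order $n$ at $\mathbf{x}_0$, i.e. all partial derivatives of $u$ of order at most $n-1$ vanish at $\mathbf{x}_0$.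
   Context: No boundary condition is imposed on $\partial\Omega$; $u$ is real-analytic in $\Omega$. ''Vanishes up to order $n$'' means every homogeneous term of degree $<n$ in the Taylor expansion of $u$ at $\mathbf{x}_0$ vanishes. *)

(* Defs.v *)
From HB Require Import structures.
From mathcomp Require Import all_boot all_order all_algebra.
From mathcomp Require Import all_classical all_reals all_analysis.
Set Implicit Arguments. Unset Strict Implicit. Unset Printing Implicit Defensive.
Import Order.TTheory GRing.Theory Num.Theory.
Import numFieldNormedType.Exports.
Local Open Scope classical_set_scope.
Local Open Scope ring_scope.

Definition dx {R : realType} (f : R * R -> R) : R * R -> R :=
  fun p => derive1 (fun t : R => f (t, p.2)) p.1.
Definition dy {R : realType} (f : R * R -> R) : R * R -> R :=
  fun p => derive1 (fun t : R => f (p.1, t)) p.2.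

Definition pderiv {R : realType} (s : seq bool) (f : R * R -> R) : R * R -> R :=
  foldr (fun b g => if b then dx g else dy g) f s.

Definition laplacian {R : realType} (f : R * R -> R) : R * R -> R :=
  fun p => dx (dx f) p + dy (dy f) p.

Definition real_analytic_on {R : realType} (O : set (R * R)) (f : R * R -> R) :=
  forall p0, O p0 -> exists r : R, 0 < r /\ exists a : nat -> nat -> R,
    forall p, `|p.1 - p0.1| < r -> `|p.2 - p0.2| < r ->
      cvg ((fun N : nat => \sum_(i < N) \sum_(j < N)
              `|a i j| * `|p.1 - p0.1| ^+ i * `|p.2 - p0.2| ^+ j) @ \oo) /\
      ((fun N : nat => \sum_(i < N) \sum_(j < N)
              a i j * (p.1 - p0.1) ^+ i * (p.2 - p0.2) ^+ j) @ \oo --> f p).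

Definition leb2 {R : realType} :=
  ((@lebesgue_measure R) \x (@lebesgue_measure R))%E.

Definition L2_on {R : realType} (O : set (R * R)) (u : R * R -> R) :=
  measurable (O : set (measurableTypeR R * measurableTypeR R)%type) /\
  leb2.-integrable (O : set (measurableTypeR R * measurableTypeR R)%type)
    (fun p => ((u p) ^+ 2)%:E).

Definition segment {R : realType} (x0 e : R * R) (h : R) : set (R * R) :=
  [set p | exists2 t, 0 <= t <= h & p = (x0.1 + t * e.1, x0.2 + t * e.2)].

(* Main.v *)
(** If all Taylor terms of [u] of degree less than [m] vanish at [x0], where
    [1 <= m <= n - 1], the equation makes the term [P] of degree [m] harmonic:
    with [e = (cos theta, sin theta)], [P (r * e)] is
    [r ^ m * (a cos (m theta) + b sin (m theta))].  The lowest-order term of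
    the Neumann data along a ray of angle [theta] is then proportional to
    [b cos (m theta) - a sin (m theta)].  It vanishes on two rays at angle
    [alpha * pi], so that [P = 0] unless [sin (m alpha pi) = 0]; but the latter
    means [alpha = q / m] for some [0 < q < m].  Termwise differentiation of
    double power series yields all partial derivatives from the coefficients. *)

Require Import Defs.
From HB Require Import structures.
From mathcomp Require Import all_boot all_order all_algebra.
From mathcomp Require Import all_classical all_reals all_analysis.
From mathcomp Require Import ring lra.
Import Order.TTheory GRing.Theory Num.Theory.
Import numFieldNormedType.Exports.
Local Open Scope classical_set_scope.
Local Open Scope ring_scope.

(** * Rectangular partial sums of double series with geometric bounds *)

Lemma sum_geometric_le {R : realType} (q : R) (N : nat) :
  0 <= q < 1 -> \sum_(i < N) q ^+ i <= (1 - q)^-1.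
Proof.
move=> /andP[q0 q1]; have q1' : 0 < 1 - q by rewrite subr_gt0.
rewrite -(ler_pM2l q1') divff ?gt_eqF// -[1 - q]opprB mulNr -subrX1 opprB.
by rewrite lerBlDr lerDl exprn_ge0.
Qed.

Definition rectsum {R : realType} (b : nat -> nat -> R) (m n : nat) : R :=
  \sum_(i < m) \sum_(j < n) b i j.

Lemma rectsum_recl {R : realType} (b : nat -> nat -> R) (m n : nat) :
  rectsum b m.+1 n = \sum_(j < n) b 0%N j + rectsum (fun i => b i.+1) m n.
Proof. by rewrite /rectsum big_ord_recl. Qed.

Lemma rectsum_recr {R : realType} (b : nat -> nat -> R) (m n : nat) :
  rectsum b m.+1 n = rectsum b m n + \sum_(j < n) b m j.
Proof. by rewrite /rectsum big_ord_recr. Qed.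

Lemma rectsumC {R : realType} (b : nat -> nat -> R) (m n : nat) :
  rectsum b m n = rectsum (fun i j => b j i) n m.
Proof. by rewrite /rectsum exchange_big. Qed.

Lemma eq_rectsum {R : realType} (b c : nat -> nat -> R) (m n : nat) :
  (forall i j, b i j = c i j) -> rectsum b m n = rectsum c m n.
Proof. by move=> bc; apply: eq_bigr => i _; apply: eq_bigr => j _. Qed.

Lemma rectsumD {R : realType} (b c : nat -> nat -> R) (m n : nat) :
  rectsum (fun i j => b i j + c i j) m n = rectsum b m n + rectsum c m n.
Proof. by rewrite -big_split; apply: eq_bigr => i _; rewrite -big_split. Qed.

Lemma rectsumZ {R : realType} (k : R) (b : nat -> nat -> R) (m n : nat) :
  rectsum (fun i j => k * b i j) m n = k * rectsum b m n.
Proof. by rewrite mulr_sumr; apply: eq_bigr => i _; rewrite -mulr_sumr. Qed.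

Lemma rectsumB {R : realType} (b c : nat -> nat -> R) (m n : nat) :
  rectsum (fun i j => b i j - c i j) m n = rectsum b m n - rectsum c m n.
Proof. by rewrite -sumrB; apply: eq_bigr => i _; rewrite -sumrB. Qed.

Lemma rectsum_square_nondecreasing {R : realType} (b : nat -> nat -> R) :
  (forall i j, 0 <= b i j) ->
  {homo (fun N => rectsum b N N) : m n / (m <= n)%N >-> m <= n}.
Proof.
move=> b0; apply: homo_leq => // [|N]; first exact: le_trans.
rewrite rectsum_recr (rectsumC b N N.+1) rectsum_recr -(rectsumC b N N) -addrA lerDl.
by rewrite addr_ge0//; apply: sumr_ge0.
Qed.

Lemma rectsum_term_le {R : realType} (b : nat -> nat -> R) (i j N : nat) :
  (forall i j, 0 <= b i j) -> (i < N)%N -> (j < N)%N -> b i j <= rectsum b N N.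
Proof.
move=> b0 iN jN; rewrite /rectsum (bigD1 (Ordinal iN))//= (bigD1 (Ordinal jN))//=.
rewrite -addrA lerDl addr_ge0//; first exact: sumr_ge0.
by apply: sumr_ge0 => *; exact: sumr_ge0.
Qed.

Lemma rectsum_le {R : realType} (b : nat -> nat -> R) (K q : R) (m n : nat) :
  0 <= q < 1 -> (forall i j, `|b i j| <= K * q ^+ (i + j)) ->
  `|rectsum b m n| <= K * (1 - q)^-1 ^+ 2.
Proof.
move=> q01 bK.
have K0 : 0 <= K.
  by rewrite (le_trans (normr_ge0 (b 0%N 0%N)))//
    (le_trans (bK _ _))// mulr1.
have q1 : 0 < 1 - q by rewrite subr_gt0; case/andP: q01.
have q0 : 0 <= q by case/andP: q01.
apply: (@le_trans _ _ (\sum_(i < m) K * (1 - q)^-1 * q ^+ i)).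
  apply: le_trans (ler_norm_sum _ _ _) _; apply: ler_sum => i _.
  apply: le_trans (ler_norm_sum _ _ _) _.
  apply: (@le_trans _ _ (K * q ^+ i * \sum_(j < n) q ^+ j)).
    by rewrite mulr_sumr; apply: ler_sum => j _; rewrite -mulrA -exprD bK.
  rewrite mulrAC ler_wpM2r ?exprn_ge0// ler_wpM2l//.
  exact: sum_geometric_le.
rewrite -mulr_sumr expr2 mulrA ler_wpM2l//; last exact: sum_geometric_le.
by rewrite mulr_ge0// invr_ge0 ltW.
Qed.

(** For nonnegative terms the sums over squares are monotone and bounded; a signed [b] is the
    difference of the nonnegative families [|b| + b] and [|b|]. *)
Lemma rectsum_square_cvg {R : realType} (b : nat -> nat -> R) (K q : R) :
  0 <= q < 1 -> (forall i j, `|b i j| <= K * q ^+ (i + j)) ->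
  cvg ((fun N => rectsum b N N) @ \oo).
Proof.
move=> q01 bK.
have nonneg (c : nat -> nat -> R) L : (forall i j, 0 <= c i j) ->
    (forall i j, `|c i j| <= L * q ^+ (i + j)) ->
    cvg ((fun N => rectsum c N N) @ \oo).
  move=> c0 cK; apply: nondecreasing_is_cvgn.
    exact: rectsum_square_nondecreasing.
  exists (L * (1 - q)^-1 ^+ 2) => _ [N _ <-].
  by rewrite (le_trans (ler_norm _))//; apply: rectsum_le.
have -> : (fun N => rectsum b N N) =
    (fun N => rectsum (fun i j => `|b i j| + b i j) N N) \-
    (fun N => rectsum (fun i j => `|b i j|) N N).
  by apply/funext => N /=; rewrite rectsumD; ring.
apply: is_cvgB; last by apply: (nonneg _ K) => // i j; rewrite normr_id.
apply: (nonneg _ (K + K)) => i j; first by have := ler_norm (- b i j); rewrite normrN; lra.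
by rewrite mulrDl (le_trans (ler_normD _ _))// normr_id lerD.
Qed.

(** Differentiation shifts the row index by one, which changes a sum over a square by its last row;
    this makes the change negligible in the limit. *)
Lemma rectsum_lastrow_cvg0 {R : realType} (b : nat -> nat -> R) (K q : R) :
  0 <= q < 1 -> (forall i j, `|b i j| <= K * q ^+ (i + j)) ->
  ((fun N => \sum_(j < N) b N j) @ \oo) --> (0 : R).
Proof.
move=> q01 bK; have /andP[q0 q1] := q01.
have K0 : 0 <= K.
  by rewrite (le_trans (normr_ge0 (b 0%N 0%N)))//
    (le_trans (bK _ _))// mulr1.
apply/norm_cvg0P; apply: (@squeeze_cvgr _ _ _ _ (cst 0) (geometric (K * (1 - q)^-1) q)).
- near=> N; rewrite normr_ge0/= (le_trans (ler_norm_sum _ _ _))//.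
  apply: (@le_trans _ _ (K * q ^+ N * \sum_(j < N) q ^+ j)).
    by rewrite mulr_sumr; apply: ler_sum => j _; rewrite -mulrA -exprD bK.
  rewrite mulrAC ler_wpM2r ?exprn_ge0// ler_wpM2l//.
  exact: sum_geometric_le.
- exact: cvg_cst.
- by apply: cvg_geometric; rewrite ger0_norm.
Unshelve. all: by end_near. Qed.

(** * Local expansions in double power series *)

Lemma cvg_ext {R : realType} (u v : nat -> R) (l : R) :
  (forall N, u N = v N) -> u @ \oo --> l -> v @ \oo --> l.
Proof. by move=> /funext ->. Qed.

(** The bound on the coefficients replaces absolute convergence: on any smaller square it makes the
    terms decay geometrically, and it survives sums, multiples and, after shrinking [rho],
    derivatives. *)
Definition expansion {R : realType} (a : nat -> nat -> R) (f : R * R -> R)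
    (p : R * R) (rho : R) : Prop :=
  [/\ 0 < rho,
      exists M, forall i j, `|a i j| * rho ^+ (i + j) <= M &
      forall x y, `|x| < rho -> `|y| < rho ->
        (fun N => rectsum (fun i j => a i j * x ^+ i * y ^+ j) N N) @ \oo
          --> f (p.1 + x, p.2 + y)].

Lemma expansion_exists {R : realType} (O : set (R * R)) (f : R * R -> R) (p : R * R) :
  real_analytic_on O f -> O p -> exists a rho, expansion a f p rho.
Proof.
move=> fO Op; have [r [r0 [a fa]]] := fO _ Op.
exists a, (r / 2); have r20 : 0 < r / 2 by rewrite divr_gt0.
have r2r : r / 2 < r by lra.
have fa' x y : `|x| < r -> `|y| < r ->
    cvg ((fun N => rectsum (fun i j => `|a i j| * `|x| ^+ i * `|y| ^+ j) N N) @ \oo) /\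
    (fun N => rectsum (fun i j => a i j * x ^+ i * y ^+ j) N N) @ \oo
      --> f (p.1 + x, p.2 + y).
  move=> xr yr.
  have := fa (p.1 + x, p.2 + y); rewrite /= ![_ + _ - _]addrAC !subrr !add0r.
  exact.
split => //; last first.
  by move=> x y xr yr; apply: (fa' _ _ _ _).2; rewrite (lt_trans _ r2r).
have r2n : `|r / 2| < r by rewrite gtr0_norm.
have [cva _] := fa' _ _ r2n r2n.
(* At the corner [(r / 2, r / 2)] the series converges absolutely, so each of its terms is at most
   the sum of the absolute values. *)
exists (limn (fun N => rectsum (fun i j => `|a i j| * `|r / 2| ^+ i * `|r / 2| ^+ j) N N)).
move=> i j; rewrite exprD mulrA -{1 2}(gtr0_norm r20).
have pos i' j' : 0 <= `|a i' j'| * `|r / 2| ^+ i' * `|r / 2| ^+ j'.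
  by rewrite !mulr_ge0// exprn_ge0.
apply: (@le_trans _ _ (rectsum (fun i j => `|a i j| * `|r / 2| ^+ i * `|r / 2| ^+ j)
  (i + j).+1 (i + j).+1)).
  apply: (rectsum_term_le (fun i j => `|a i j| * `|r / 2| ^+ i * `|r / 2| ^+ j)) => //.
    by rewrite ltnS leq_addr.
  by rewrite ltnS leq_addl.
exact: (nondecreasing_cvgn_le (rectsum_square_nondecreasing _ pos) cva).
Qed.

Lemma expansion_le {R : realType} (a : nat -> nat -> R) f p (rho sigma : R) :
  0 < sigma <= rho -> expansion a f p rho -> expansion a f p sigma.
Proof.
move=> /andP[s0 sr] [r0 [M aM] cv]; split=> //.
  exists M => i j; apply: le_trans (aM i j); rewrite ler_wpM2l// lerXn2r//.
    by rewrite nnegrE ltW.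
  by rewrite nnegrE ltW.
by move=> x y xs ys; apply: cv; apply: lt_le_trans sr.
Qed.

Lemma expansionD {R : realType} (a b : nat -> nat -> R) f g p (rho sigma : R) :
  expansion a f p rho -> expansion b g p sigma ->
  expansion (fun i j => a i j + b i j) (fun z => f z + g z) p (Num.min rho sigma).
Proof.
move=> fa gb; have [r0 _ _] := fa; have [s0 _ _] := gb.
have m0 : 0 < Num.min rho sigma by rewrite lt_min r0.
have {fa}[_ [M aM] cva] : expansion a f p (Num.min rho sigma).
  by apply: expansion_le fa; rewrite m0 ge_min lexx.
have {gb}[_ [L bL] cvb] : expansion b g p (Num.min rho sigma).
  by apply: expansion_le gb; rewrite m0 ge_min lexx orbT.
split=> //.
  exists (M + L) => i j; rewrite (le_trans _ (lerD (aM i j) (bL i j)))// -mulrDl.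
  by rewrite ler_wpM2r ?ler_normD// exprn_ge0// ltW.
move=> x y xr yr; apply: (cvg_ext _ _ _ _ (cvgD (cva x y xr yr) (cvb x y xr yr))) => N /=.
apply: etrans (esym (rectsumD _ _ _ _)) _; apply: eq_rectsum => i j; ring.
Qed.

Lemma expansionZ {R : realType} (k : R) (a : nat -> nat -> R) f p (rho : R) :
  expansion a f p rho ->
  expansion (fun i j => k * a i j) (fun z => k * f z) p rho.
Proof.
move=> [r0 [M aM] cv]; split=> //.
  by exists (`|k| * M) => i j; rewrite normrM -mulrA ler_wpM2l.
move=> x y xr yr; apply: (cvg_ext _ _ _ _ (cvgM (cvg_cst k) (cv x y xr yr))) => N /=.
apply: etrans (esym (rectsumZ _ _ _ _)) _; apply: eq_rectsum => i j; ring.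
Qed.

(** Exchanging the variables turns [dy] into [dx], so that termwise differentiation is proved in one
    variable only. *)
Definition swap_arg {R : realType} (f : R * R -> R) : R * R -> R :=
  fun z => f (z.2, z.1).

Lemma expansion_swap {R : realType} (a : nat -> nat -> R) f p (rho : R) :
  expansion a f p rho ->
  expansion (fun i j => a j i) (swap_arg f) (p.2, p.1) rho.
Proof.
move=> [r0 [M aM] cv]; split=> //.
  by exists M => i j; rewrite addnC.
move=> x y xr yr; apply: (cvg_ext _ _ _ _ (cv y x yr xr)) => N /=.
rewrite rectsumC; apply: eq_rectsum => i j; ring.
Qed.

Lemma expansion_center {R : realType} (a : nat -> nat -> R) f p (rho : R) :
  expansion a f p rho -> f p = a 0%N 0%N.
Proof.
move=> [r0 _ /(_ 0 0)]; rewrite normr0 !addr0 -surjective_pairing => /(_ r0 r0) cv.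
apply: (cvg_unique _ cv) => //.
apply: cvg_near_cst; exists 1%N => //= -[//|N] _.
rewrite /rectsum big_ord_recl big_ord_recl/= !expr0 !mulr1.
rewrite !big1 ?addr0// => [i _|i _]; first rewrite big1// => j _.
  by rewrite expr0n mulr0 mul0r.
by rewrite expr0n mulr0.
Qed.

(** * Termwise differentiation *)

(** A quadratic remainder bound passes from partial sums to their limit, so this criterion gives the
    derivative of a series without any interchange of limits. *)
Lemma derive1_quadratic {R : realType} (f : R -> R) (x g C d : R) : 0 < d ->
  (forall k, `|k| < d -> `|f (x + k) - f x - k * g| <= C * k ^+ 2) ->
  derive1 f x = g.
Proof.
move=> d0 fC; rewrite /derive1; apply: cvg_lim => //.
have C0 : 0 <= C.
  have := fC (d / 2); rewrite gtr0_norm ?divr_gt0// => /(_ ltac:(lra)).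
  move=> /(le_trans (normr_ge0 _)); rewrite pmulr_lge0// exprn_gt0//.
  by rewrite divr_gt0.
apply/cvgrPdist_le => e e0; near=> k.
have k0 : k != 0 by near: k; exact: nbhs_dnbhs_neq.
have kd : `|k| < d by near: k; apply: dnbhs0_lt.
have ke : `|k| < e / (C + 1) by near: k; apply: dnbhs0_lt; rewrite divr_gt0//; lra.
have nk0 : 0 < `|k| by rewrite normr_gt0.
rewrite /GRing.scale/= -(ler_pM2l nk0) -normrM mulrBr mulVKf//.
rewrite distrC (addrC k x); apply: le_trans (fC _ kd) _.
rewrite -real_normK ?num_real// expr2 mulrCA ler_pM2l//.
move: ke; rewrite ltr_pdivlMr; last lra.
by move: nk0; nra.
Unshelve. all: by end_near. Qed.

(** The factor [s ^+ 2] on the left avoids the exponent [i - 2] on the right. The remainder of order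
    [i.+1] is [x + k] times that of order [i], plus [i * x ^ (i - 1) * k ^ 2]; the induction closes
    because [i ^ 2 + i <= (i + 1) ^ 2]. *)
Lemma exprD_remainder {R : realType} (x k s : R) (i : nat) :
  `|x| <= s -> `|x + k| <= s ->
  `|(x + k) ^+ i - x ^+ i - i%:R * x ^+ i.-1 * k| * s ^+ 2
    <= i%:R ^+ 2 * s ^+ i * k ^+ 2.
Proof.
move=> xs xks; have s0 : 0 <= s by apply: le_trans xs.
elim: i => [|i IH]; first by rewrite !expr0 !mul0r !subrr normr0 expr0n !mul0r.
rewrite [X in `|X|](_ : _ = (x + k) * ((x + k) ^+ i - x ^+ i - i%:R * x ^+ i.-1 * k)
    + i%:R * x ^+ i.-1 * k ^+ 2); last first.
  by case: i {IH} => [|i] /=; rewrite ?exprS -?natr1; ring.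
have A : `|x + k| * (`|(x + k) ^+ i - x ^+ i - i%:R * x ^+ i.-1 * k| * s ^+ 2)
    <= s * (i%:R ^+ 2 * s ^+ i * k ^+ 2).
  by apply: ler_pM => //; rewrite mulr_ge0// exprn_ge0.
have B : `|i%:R * x ^+ i.-1 * k ^+ 2| * s ^+ 2 <= i%:R * s ^+ i.+1 * k ^+ 2.
  rewrite normrM (ger0_norm (sqr_ge0 k)) normrM normrX normr_nat.
  case: i {IH A} => [|i]; first by rewrite !mul0r.
  rewrite /= [leRHS](_ : _ = i.+1%:R * s ^+ i * k ^+ 2 * s ^+ 2); last by rewrite !exprS; ring.
  rewrite ler_wpM2r ?sqr_ge0// ler_wpM2r ?sqr_ge0// ler_wpM2l//.
  by rewrite lerXn2r ?nnegrE.
apply: le_trans (ler_wpM2r (sqr_ge0 s) (ler_normD _ _)) _.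
rewrite mulrDl normrM -mulrA; apply: le_trans (lerD A B) _.
rewrite -subr_ge0 (_ : _ - _ = i.+1%:R * s ^+ i.+1 * k ^+ 2).
  by rewrite mulr_ge0 ?sqr_ge0// mulr_ge0// exprn_ge0.
by rewrite !exprS -natr1; ring.
Qed.

Definition dx_coef {R : realType} (a : nat -> nat -> R) : nat -> nat -> R :=
  fun i j => i.+1%:R * a i.+1 j.

Definition dy_coef {R : realType} (a : nat -> nat -> R) : nat -> nat -> R :=
  fun i j => j.+1%:R * a i j.+1.

Lemma sqr_geometric_le {R : realType} (i j : nat) :
  i%:R ^+ 2 * 8^-1 ^+ (i + j) <= 2^-1 ^+ (i + j) :> R.
Proof.
(* The factor [2^-1] keeps the geometric decay, while [4^-1] absorbs [i ^ 2], since [i < 2 ^ i]. *)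
rewrite (_ : 8^-1 = 2^-1 * 4^-1 :> R); last by field.
rewrite exprMn mulrCA ler_piMr ?exprn_ge0 ?invr_ge0// exprVn.
rewrite ler_pdivrMr ?exprn_gt0// mul1r.
rewrite (_ : 4 = 2 ^+ 2 :> R); last by ring.
rewrite -exprM mulnC exprM lerXn2r ?nnegrE ?exprn_ge0//.
rewrite -natrX ler_nat (leq_trans (ltnW (ltn_expl i (ltnSn 1))))//.
by rewrite leq_pexp2l// leq_addr.
Qed.

(* Shrinking the radius by 8 absorbs the factor [i ^ 2] of the quadratic
   remainder, which is thus bounded uniformly over the partial sums. *)
Lemma expansion_dx {R : realType} (a : nat -> nat -> R) f p (rho : R) :
  expansion a f p rho -> expansion (dx_coef a) (dx f) p (rho / 8).
Proof.
move=> [r0 [M aM] cv]; set s := rho / 8.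
have s0 : 0 < s by rewrite divr_gt0.
have sr : s < rho by rewrite /s; lra.
have M0 : 0 <= M.
  by rewrite (le_trans _ (aM 0%N 0%N))// mulr1.
have half01 : 0 <= (2^-1 : R) < 1 by lra.
have D i j : i%:R ^+ 2 * (`|a i j| * s ^+ (i + j)) <= M * 2^-1 ^+ (i + j).
  rewrite (_ : _ * _ = `|a i j| * rho ^+ (i + j) * (i%:R ^+ 2 * 8^-1 ^+ (i + j))).
    by rewrite ler_pM ?sqr_geometric_le// mulr_ge0 ?sqr_ge0 ?exprn_ge0 ?invr_ge0 ?(ltW r0).
  by rewrite /s exprMn; ring.
clearbody s.
(* [T] is the differentiated series still indexed by the original exponents, to match [a i j] in the
   difference quotient. Its row [0] vanishes through the factor [i], whatever [i.-1] is there. *)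
pose T x y i j := i%:R * a i j * x ^+ i.-1 * y ^+ j.
have TK x y i j : `|x| <= s -> `|y| <= s -> `|T x y i j| <= M / s * 2^-1 ^+ (i + j).
  move=> xs ys; rewrite mulrAC ler_pdivlMr//; case: i => [|i].
    by rewrite /T !mul0r normr0 mul0r mulr_ge0// exprn_ge0.
  apply: le_trans (D _ _); rewrite /T !normrM !normrX normr_nat/=.
  apply: (@le_trans _ _ (i.+1%:R * `|a i.+1 j| * s ^+ i * s ^+ j * s)).
    rewrite ler_wpM2r ?(ltW s0)// ler_pM ?mulr_ge0 ?exprn_ge0//.
      by rewrite ler_wpM2l ?mulr_ge0// lerXn2r ?nnegrE// ltW.
    by rewrite lerXn2r ?nnegrE// ltW.
  rewrite (_ : i.+1%:R * _ * _ * _ * _ = i.+1%:R * (`|a i.+1 j| * s ^+ (i.+1 + j))).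
    rewrite ler_wpM2r ?mulr_ge0 ?exprn_ge0 ?(ltW s0)//.
    by rewrite expr2 ler_peMl// ler1n.
  by rewrite exprD exprS; ring.
split=> //.
  exists (M / s) => i j; have := TK s s i.+1 j.
  rewrite gtr0_norm// lexx => /(_ isT isT).
  rewrite /T/= normrM normrX normrM normrX (gtr0_norm s0) -mulrA -exprD => le1.
  apply: le_trans le1 _; rewrite ler_piMr ?divr_ge0 ?(ltW s0)//.
  by rewrite exprn_ile1//; lra.
move=> x y xs ys.
have xs' := ltW xs; have ys' := ltW ys.
have bnd i j : `|dx_coef a i j * x ^+ i * y ^+ j| <= M / s * 2^-1 ^+ (i + j).
  apply: le_trans (TK x y i.+1 j xs' ys') _.
  rewrite ler_wpM2l ?divr_ge0 ?(ltW s0)// addSn exprS ler_piMl ?exprn_ge0//; lra.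
have /cvg_ex[g cvg] := rectsum_square_cvg _ _ _ half01 bnd.
(* The sum of [T] over a square is that of the [dx_coef] series minus the last row of [T], which
   tends to zero. *)
have cvT : (fun N => rectsum (T x y) N N) @ \oo --> g.
  have c0 := rectsum_lastrow_cvg0 (T x y) (M / s) 2^-1 half01 (fun i j => TK x y i j xs' ys').
  rewrite -[g]subr0; apply: (cvg_ext _ _ _ _ (cvgB cvg c0)) => N.
  have := rectsum_recr (T x y) N N; rewrite rectsum_recl big1 => [|j _]; last first.
    by rewrite /T !mul0r.
  by rewrite add0r => E; apply/eqP; rewrite subr_eq; apply/eqP.
suff -> : dx f (p.1 + x, p.2 + y) = g by [].
(* The factor [s ^+ 2] comes from [exprD_remainder], the squared inverse from the double geometric
   series of ratio one half; the radius [s - |x|] keeps [x + k] within [s]. *)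
apply: (@derive1_quadratic _ _ _ _ (M / s ^+ 2 * (1 - 2^-1)^-1 ^+ 2) (s - `|x|)).
  by rewrite subr_gt0.
move=> k ks /=.
have xks : `|x + k| < s by rewrite (le_lt_trans (ler_normD _ _))//; lra.
pose proof (cvgB (cvgB (cv (x + k) y (lt_trans xks sr) (lt_trans ys sr))
  (cv x y (lt_trans xs sr) (lt_trans ys sr))) (cvgM (cvg_cst k) cvT)) as c.
rewrite addrA in c; pose proof (cvg_norm c) as c'; apply: (cvgr_to_le c'); near=> N => /=.
rewrite [X in `|X|](_ : _ = rectsum (fun i j =>
   a i j * y ^+ j * ((x + k) ^+ i - x ^+ i - i%:R * x ^+ i.-1 * k)) N N); last first.
  rewrite -[X in X = _]/(rectsum _ N N - rectsum _ N N - k * rectsum _ N N).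
  rewrite -rectsumZ -!rectsumB; apply: eq_rectsum => i j; rewrite /T; ring.
rewrite mulrAC [M / _ * _]mulrAC; apply: rectsum_le => // i j.
rewrite [leRHS]mulrAC ler_pdivlMr ?exprn_gt0// !normrM.
apply: (@le_trans _ _ (`|a i j| * s ^+ j * (i%:R ^+ 2 * s ^+ i * k ^+ 2))).
  rewrite -[leLHS]mulrA; apply: ler_pM; rewrite ?mulr_ge0 ?(ltW s0)//.
    by rewrite ler_wpM2l// normrX lerXn2r// ?nnegrE// ltW.
  by apply: exprD_remainder => //; exact: ltW.
rewrite [leLHS](_ : _ = k ^+ 2 * (i%:R ^+ 2 * (`|a i j| * s ^+ (i + j)))); last first.
  by rewrite (exprD s); ring.
by rewrite [M * _]mulrC -[leRHS]mulrA ler_wpM2l ?sqr_ge0.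
Unshelve. all: by end_near. Qed.

Lemma expansion_dy {R : realType} (a : nat -> nat -> R) f p (rho : R) :
  expansion a f p rho -> expansion (dy_coef a) (dy f) p (rho / 8).
Proof.
move=> /expansion_swap /expansion_dx /expansion_swap.
by rewrite -surjective_pairing.
Qed.

(** * Coefficients forced to vanish, on a square or along a ray *)

(** Up to a nonzero integer factor, each coefficient of positive degree is a lower coefficient of a
    derivative, and the derivatives also vanish on the square of radius [d]. The induction keeps [d]
    fixed while [rho] shrinks. *)
Lemma expansion_zero {R : realType} (a : nat -> nat -> R) f p (rho d : R) :
  expansion a f p rho -> 0 < d ->
  (forall x y, `|x| < d -> `|y| < d -> f (p.1 + x, p.2 + y) = 0) ->
  forall i j, a i j = 0.
Proof.
move=> fa d0 f0 i j; elim: i j a f p rho fa f0 => [|i IHi].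
  elim=> [|j IHj] a f p rho fa f0.
    rewrite -(expansion_center _ _ _ _ fa).
    by have := f0 0 0; rewrite normr0 !addr0 -surjective_pairing; apply.
  have /eqP : dy_coef a 0%N j = 0.
    apply: (IHj _ _ _ _ (expansion_dy _ _ _ _ fa)) => x y xd yd.
    apply: (@derive1_quadratic _ _ _ _ 0 (d - `|y|)); first by rewrite subr_gt0.
    move=> k kd /=; rewrite -[p.2 + y + k]addrA !f0 ?subrr ?mulr0 ?subrr ?normr0 ?mul0r//.
    by rewrite (le_lt_trans (ler_normD _ _))//; lra.
  by rewrite mulf_eq0 pnatr_eq0 => /eqP.
move=> j a f p rho fa f0; have /eqP : dx_coef a i j = 0.
  apply: (IHi _ _ _ _ _ (expansion_dx _ _ _ _ fa)) => x y xd yd.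
  apply: (@derive1_quadratic _ _ _ _ 0 (d - `|x|)); first by rewrite subr_gt0.
  move=> k kd /=; rewrite -[p.1 + x + k]addrA !f0 ?subrr ?mulr0 ?subrr ?normr0 ?mul0r//.
  by rewrite (le_lt_trans (ler_normD _ _))//; lra.
by rewrite mulf_eq0 pnatr_eq0 => /eqP.
Qed.

Lemma rectsum_antidiagonal {R : realType} (F : nat -> nat -> R) (m N : nat) :
  (m < N)%N ->
  rectsum (fun i j => if (i + j == m)%N then F i j else 0) N N
    = \sum_(i < m.+1) F i (m - i)%N.
Proof.
move=> mN; rewrite (big_ord_widen N (fun i => F i (m - i)%N) mN) big_mkcond.
apply: eq_bigr => i _; rewrite ltnS -big_mkcond; case: leqP => [im|mi].
  have jN : (m - i < N)%N by rewrite (leq_ltn_trans (leq_subr _ _)).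
  rewrite (big_pred1 (Ordinal jN))// => j /=.
  by rewrite -[X in _ == X](subnKC im) eqn_add2l;
    apply/eqP/eqP => [|->] // ?; apply: val_inj.
rewrite big_pred0// => j; apply/eqP => ijm.
by move: mi; rewrite -ijm ltnNge leq_addr.
Qed.

(** On the ray, [0 = t ^ m * Q + O(t ^ (m + 1))] with [Q] the value at [(e1, e2)] of the lowest
    homogeneous term; dividing by [t ^ m] and letting [t] tend to zero gives [Q = 0]. *)
Lemma expansion_ray {R : realType} (a : nat -> nat -> R) f p (rho h e1 e2 : R)
    (m : nat) :
  expansion a f p rho -> (forall i j, (i + j < m)%N -> a i j = 0) ->
  0 < h -> `|e1| <= 1 -> `|e2| <= 1 ->
  (forall t, 0 <= t <= h -> f (p.1 + t * e1, p.2 + t * e2) = 0) ->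
  \sum_(i < m.+1) a i (m - i)%N * e1 ^+ i * e2 ^+ (m - i) = 0.
Proof.
move=> [r0 [M aM] cv] a0 h0 e1le e2le f0; set Q := \sum_(i < _) _.
set s := rho / 2; have s0 : 0 < s by rewrite divr_gt0.
have sr : s < rho by rewrite /s; lra.
have M0 : 0 <= M by rewrite (le_trans _ (aM 0%N 0%N))// mulr1.
have as_ i j : `|a i j| * s ^+ (i + j) <= M * 2^-1 ^+ (i + j).
  by rewrite exprMn mulrA ler_wpM2r ?exprn_ge0.
have half01 : 0 <= (2^-1 : R) < 1 by lra.
clearbody s; pose C := M * (1 - 2^-1)^-1 ^+ 2 / s ^+ m.+1.
have C0 : 0 <= C by rewrite divr_ge0 ?mulr_ge0 ?exprn_ge0 ?(ltW s0)// invr_ge0; lra.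
have main t : 0 < t -> t <= h -> t <= s -> `|Q| <= C * t.
  move=> t0 th ts; have tr : t < rho by apply: le_lt_trans sr.
  have tele e : `|e| <= 1 -> `|t * e| < rho.
    by move=> ele; rewrite normrM gtr0_norm// (le_lt_trans _ tr)// ler_piMr// ltW.
  have := cv _ _ (tele _ e1le) (tele _ e2le).
  rewrite f0 ?th ?(ltW t0)// => c.
  rewrite -(ler_pM2l (exprn_gt0 m t0)).
  rewrite (_ : _ * (C * t) = M * (t / s) ^+ m.+1 * (1 - 2^-1)^-1 ^+ 2); last first.
    by rewrite /C expr_div_n (exprS t); ring.
  (* The partial sums tend to zero on the ray, so [t ^+ m * Q] is estimated through its difference
     with them, in which the terms of degree [m] cancel. *)
  pose proof (cvg_norm (cvgB (cvg_cst (t ^+ m * Q)) c)) as c'.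
  rewrite subr0 normrM (gtr0_norm (exprn_gt0 m t0)) in c'.
  apply: (cvgr_to_le c'); exists m.+1 => // N /= mN.
  pose b i j := if (i + j == m)%N then 0 else - (a i j * (t * e1) ^+ i * (t * e2) ^+ j).
  rewrite [X in `|X|](_ : _ = rectsum b N N).
    have ts0 : 0 <= t / s by rewrite divr_ge0 ?(ltW t0) ?(ltW s0).
    have K0 : 0 <= M * (t / s) ^+ m.+1 by rewrite mulr_ge0 ?exprn_ge0.
    apply: rectsum_le => // i j; rewrite /b; case: eqP => [_|/eqP ijm].
      by rewrite normr0 mulr_ge0 ?exprn_ge0 ?invr_ge0.
    have [ijm'|] := ltnP (i + j) m.
      by rewrite a0// !mul0r oppr0 normr0 mulr_ge0 ?exprn_ge0 ?invr_ge0.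
    rewrite leq_eqVlt eq_sym (negbTE ijm)/= => mij.
    apply: (@le_trans _ _ (`|a i j| * s ^+ (i + j) * (t / s) ^+ (i + j))).
      rewrite -[leRHS]mulrA -exprMn mulrCA divff ?gt_eqF// mulr1 normrN !normrM.
      rewrite -[leLHS]mulrA ler_wpM2l// !normrX !normrM (gtr0_norm t0) exprD.
      by rewrite ler_pM ?exprn_ge0 ?mulr_ge0 ?(ltW t0)//
         lerXn2r ?nnegrE ?mulr_ge0 ?(ltW t0)//
         ler_piMr ?(ltW t0).
    rewrite [leRHS]mulrAC ler_pM ?mulr_ge0 ?exprn_ge0 ?(ltW s0)//.
    by apply: ler_wiXn2l => //; rewrite ler_pdivrMr ?mul1r.
  rewrite -[X in X = _]/(t ^+ m * Q - rectsum _ N N).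
  have := rectsum_antidiagonal (fun i j => a i j * (t * e1) ^+ i * (t * e2) ^+ j) _ _ mN.
  rewrite [X in _ = X](_ : _ = t ^+ m * Q).
    move=> <-; rewrite -rectsumB; apply: eq_rectsum => i j; rewrite /b.
    by case: eqP => _; rewrite ?subrr ?sub0r.
  rewrite mulr_sumr; apply: eq_bigr => -[i /= im] _.
  have {}im : (i <= m)%N by [].
  by rewrite !exprMn -[in t ^+ m](subnKC im) exprD; ring.
apply/eqP/negP => /negP; rewrite -normr_gt0 => Q0.
(* With this [t], [C * t] is at most [C / (C + 1)] times half of [|Q|], hence below [|Q|]; [C + 1]
   serves as divisor because [C] may be zero. *)
pose t := Num.min (Num.min h s) (`|Q| / (C + 1) / 2).
have t0 : 0 < t by rewrite !lt_min h0 s0 !divr_gt0//; lra.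
have : `|Q| <= C * t by apply: main; rewrite // !ge_min lexx ?orbT.
have : t <= `|Q| / (C + 1) / 2 by rewrite ge_min lexx orbT.
move=> /(ler_wpM2l C0) le1 /le_trans /(_ le1).
rewrite leNgt => /negP; apply; rewrite !mulrA ltr_pdivrMr// ltr_pdivrMr; last lra.
by nra.
Qed.

(** * The angle condition and harmonic forms on two rays *)

Lemma sinD_natmul_pi {R : realType} (y : R) (k : nat) :
  `|sin (y + k%:R * pi)| = `|sin y|.
Proof.
elim: k => [|k IH]; first by rewrite mul0r addr0.
by rewrite -natr1 mulrDl mul1r addrA sinDpi normrN.
Qed.

(** Subtracting from [m * alpha] its integer part [k] moves the angle into [[0, pi)] and changes the
    sine at most by a sign. Angle zero would mean [alpha = k / m], with [0 < k < m] as
    [0 < alpha < 1]. *)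
Lemma sin_natmul_pi_neq0 {R : realType} (alpha : R) (m : nat) :
  (0 < m)%N -> 0 < alpha < 1 ->
  (forall q : nat, (1 <= q)%N -> (q < m)%N -> alpha != q%:R / m%:R) ->
  sin (m%:R * (alpha * pi)) != 0.
Proof.
move=> m0 /andP[al0 al1] alq; have mR : 0 < m%:R :> R by rewrite ltr0n.
set x := m%:R * alpha; have x0 : 0 < x by rewrite mulr_gt0.
have /andP[kx xk] := truncn_itv (ltW x0); set k := Num.trunc x in kx xk.
rewrite mulrA -[m%:R * alpha]/x -(subrK k%:R x) mulrDl -normr_eq0.
rewrite sinD_natmul_pi normr_eq0 gt_eqF// sin_gt0_pi//.
have : x - k%:R != 0.
  apply/eqP => /eqP; rewrite subr_eq0 => /eqP xkE.
  have : alpha = k%:R / m%:R by rewrite -xkE /x mulrC mulKf// gt_eqF.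
  apply/eqP; apply: alq; rewrite -(ltr_nat R) -xkE//.
  by rewrite /x -[ltRHS]mulr1 ltr_pM2l.
move=> xkn; rewrite pmulr_lgt0 ?pi_gt0// lt_neqAle eq_sym xkn subr_ge0 kx/=.
by rewrite -[ltRHS]mul1r ltr_pM2r ?pi_gt0//; move: xk; rewrite -natr1; lra.
Qed.

(* [binomial_form A e1 e2 k s] is [(e2 + e1 * S) ^ k A] at [s], with [S] the
   shift of sequences.  If [S ^ 2 A = - A], the pair of its values at [s = 0, 1],
   read as a complex number, is [(e2 - i e1) ^ k * (A 0 + i A 1)]. *)
Fixpoint binomial_form {R : realType} (A : nat -> R) (e1 e2 : R) (k s : nat) : R :=
  if k is k'.+1 then
    e2 * binomial_form A e1 e2 k' s + e1 * binomial_form A e1 e2 k' s.+1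
  else A s.

Lemma binomial_formE {R : realType} (A : nat -> R) (e1 e2 : R) (k s : nat) :
  binomial_form A e1 e2 k s =
  \sum_(i < k.+1) 'C(k, i)%:R * A (s + i)%N * e1 ^+ i * e2 ^+ (k - i).
Proof.
elim: k s => [|k IH] s.
  by rewrite big_ord1 /= bin0 addn0 !expr0 !mulr1 mul1r.
rewrite /= !IH [RHS]big_ord_recl/= bin0 addn0 subn0.
under [X in _ = _ + X]eq_bigr => i _.
  rewrite binS natrD !mulrDl /bump add1n subSS addnS; over.
rewrite big_split/= addrA; congr (_ + _); last first.
  by rewrite mulr_sumr; apply: eq_bigr => i _; rewrite addSn exprS; ring.
rewrite big_ord_recl [X in _ = _ + X]big_ord_recr/= (bin_small (ltnSn k)) !mul0r addr0.
rewrite mulrDr bin0 addn0 subn0; congr (_ + _); first by rewrite exprS; ring.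
rewrite mulr_sumr; apply: eq_bigr => -[i /= ik] _.
by rewrite /bump add1n addnS -(subnSK ik) !exprS; ring.
Qed.

Lemma binomial_form_alt {R : realType} (A : nat -> R)
    (A_alt : forall i, A i.+2 = - A i) (e1 e2 : R) k s : binomial_form A e1 e2 k s.+2 = - binomial_form A e1 e2 k s.
Proof. by elim: k s => [|k IH] s //=; rewrite !IH; ring. Qed.

(** In complex terms, [e2 - i e1] has modulus one, so multiplying by its powers preserves the
    modulus of [A 0 + i A 1]. *)
Lemma binomial_form_norm {R : realType} (A : nat -> R)
    (A_alt : forall i, A i.+2 = - A i) (e : R * R) k : e.1 ^+ 2 + e.2 ^+ 2 = 1 ->
  binomial_form A e.1 e.2 k 0%N ^+ 2 + binomial_form A e.1 e.2 k 1%N ^+ 2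
    = A 0%N ^+ 2 + A 1%N ^+ 2.
Proof.
move=> e1; elim: k => [//|k IH] /=; rewrite binomial_form_alt// -IH.
by rewrite -[RHS]mul1r -e1; ring.
Qed.

(** Rotating [e] by [phi] multiplies [e2 - i e1] by [exp (i phi)], hence its power [k] by
    [exp (i k phi)]. *)
Lemma binomial_form_rotate {R : realType} (A : nat -> R)
    (A_alt : forall i, A i.+2 = - A i) (e : R * R) (phi : R) k :
  let e' := (cos phi * e.1 - sin phi * e.2, sin phi * e.1 + cos phi * e.2) in
  binomial_form A e'.1 e'.2 k 0%N =
    cos (k%:R * phi) * binomial_form A e.1 e.2 k 0%N
      - sin (k%:R * phi) * binomial_form A e.1 e.2 k 1%N /\
  binomial_form A e'.1 e'.2 k 1%N =
    sin (k%:R * phi) * binomial_form A e.1 e.2 k 0%N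
      + cos (k%:R * phi) * binomial_form A e.1 e.2 k 1%N.
Proof.
move=> e'; elim: k => [|k [IH0 IH1]].
  by rewrite mul0r cos0 sin0 /=; split; ring.
rewrite -natr1 mulrDl mul1r cosD sinD /= !binomial_form_alt// IH0 IH1 /=.
by split; ring.
Qed.

(** If the imaginary part vanishes at [e], then after rotation it is [sin (k phi)] times the real
    part at [e]. So both parts vanish at [e], and the modulus carries this back to [A]. *)
Lemma binomial_form_two_rays {R : realType} (A : nat -> R)
    (A_alt : forall i, A i.+2 = - A i) (e : R * R) (phi : R) k :
  let e' := (cos phi * e.1 - sin phi * e.2, sin phi * e.1 + cos phi * e.2) in
  e.1 ^+ 2 + e.2 ^+ 2 = 1 -> sin (k%:R * phi) != 0 ->
  binomial_form A e.1 e.2 k 1%N = 0 -> binomial_form A e'.1 e'.2 k 1%N = 0 ->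
  A 0%N = 0 /\ A 1%N = 0.
Proof.
move=> e' e1 sphi Fe; have [_ ->] := binomial_form_rotate A A_alt e phi k.
rewrite Fe mulr0 addr0 => /eqP; rewrite mulf_eq0 (negbTE sphi)/= => /eqP F0.
have /eqP := binomial_form_norm A A_alt e k e1; rewrite Fe F0 expr0n addr0 eq_sym.
by rewrite paddr_eq0 ?sqr_ge0// !sqrf_eq0 => /andP[/eqP -> /eqP ->].
Qed.

(** The sequence [x, y, -x, -y, ...] of period four solves [A i.+2 = - A i], the relation that
    harmonicity imposes on the derivatives of a fixed order. *)
Definition alternating {R : realType} (x y : R) (i : nat) : R :=
  (-1) ^+ i./2 * (if odd i then y else x).

Lemma alternatingSS {R : realType} (x y : R) i :
  alternating x y i.+2 = - alternating x y i.
Proof. by rewrite /alternating /= negbK exprS mulN1r mulNr. Qed.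

Definition normal_coef {R : realType} (a : nat -> nat -> R) (e : R * R) :
    nat -> nat -> R :=
  fun i j => - e.2 * dx_coef a i j + e.1 * dy_coef a i j.

(** The normal derivative of the harmonic term of degree [m.+1] is, up to a nonzero factor, the
    imaginary part of the complex number encoded by [binomial_form], so the two-ray argument applies
    to it. *)
Lemma harmonic_form_eq0 {R : realType} (a : nat -> nat -> R) (m : nat)
    (e : R * R) (phi : R) :
  let e' := (cos phi * e.1 - sin phi * e.2, sin phi * e.1 + cos phi * e.2) in
  let normal_form (v : R * R) := \sum_(i < m.+1)
    normal_coef a v i (m - i) * v.1 ^+ i * v.2 ^+ (m - i) in
  e.1 ^+ 2 + e.2 ^+ 2 = 1 -> sin (m.+1%:R * phi) != 0 ->
  (forall i j, (i + j).+1 = m ->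
    dx_coef (dx_coef a) i j + dy_coef (dy_coef a) i j = 0) ->
  normal_form e = 0 -> normal_form e' = 0 ->
  forall i j, (i + j = m.+1)%N -> a i j = 0.
Proof.
move=> e' normal_form e1 sphi lap Ne Ne'.
(* [A i] is the partial derivative of order [(i, m.+1 - i)] at the center,
   for [i <= m.+1]. *)
pose A := alternating (m.+1`!%:R * a 0%N m.+1) (m`!%:R * a 1%N m).
have A_alt i : A i.+2 = - A i by exact: alternatingSS.
have aA i j : (i + j = m.+1)%N -> i`!%:R * j`!%:R * a i j = A i.
  elim/ltn_ind: i j => -[|[|i]] IH j ij.
  - by rewrite /A /alternating !mul1r -ij add0n.
  - by case: ij; rewrite add0n => ->; rewrite /A /alternating !mul1r.
  rewrite A_alt -(IH i _ j.+2) ?addnS//.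
  have := lap i j; rewrite /dx_coef /dy_coef => /(_ ltac:(by case: ij)) l.
  apply/eqP; rewrite -subr_eq0 opprK !factS !natrM.
  rewrite [X in X == 0](_ : _ = i`!%:R * j`!%:R * (i.+1%:R * (i.+2%:R * a i.+2 j)
    + j.+1%:R * (j.+2%:R * a i j.+2))); last by ring.
  by rewrite l mulr0.
(* One step of the recursion gives [v.2 * F 1 + v.1 * F 2], where [F] is the form of order [m];
   since [F 2 = - F 0], its opposite is the normal derivative. *)
have NF (v : R * R) : m`!%:R * normal_form v = - binomial_form A v.1 v.2 m.+1 1%N.
  rewrite /= (binomial_form_alt _ A_alt) !binomial_formE mulrN opprD opprK.
  rewrite -mulNr !mulr_sumr -big_split; apply: eq_bigr => -[i /= im] _.
  have {}im : (i <= m)%N by [].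
  rewrite add0n add1n -(bin_fact im) natrM natrM -(aA i (m - i).+1); last first.
    by rewrite addnS subnKC.
  rewrite -(aA i.+1 (m - i)%N); last by rewrite addSn subnKC.
  by rewrite /normal_coef /dx_coef /dy_coef !factS !natrM; ring.
have F0 v : normal_form v = 0 -> binomial_form A v.1 v.2 m.+1 1%N = 0.
  by move=> Nv; apply/eqP; rewrite -oppr_eq0 -NF Nv mulr0.
have [A0 A1] := binomial_form_two_rays _ A_alt e phi m.+1 e1 sphi (F0 _ Ne) (F0 _ Ne').
have {A0 A1} A0 i : A i = 0.
  by elim/ltn_ind: i => -[|[|i]] IH //; rewrite A_alt IH ?oppr0.
move=> i j /aA; rewrite A0 => /eqP.
by rewrite !mulf_eq0 !pnatr_eq0 !eqn0Ngt !fact_gt0 => /eqP.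
Qed.

(** * From coefficients to partial derivatives, and the conclusion *)

Lemma pderiv_expansion {R : realType} (a : nat -> nat -> R) f p (rho : R) (n : nat) :
  expansion a f p rho -> (forall i j, (i + j < n)%N -> a i j = 0) ->
  forall s : seq bool, exists b sigma,
    expansion b (pderiv s f) p sigma /\ forall i j, (i + j + size s < n)%N -> b i j = 0.
Proof.
move=> fa a0; elim=> [|c s [b [sigma [fb b0]]]].
  by exists a, rho; split=> // i j; rewrite addn0; apply: a0.
exists (if c then dx_coef b else dy_coef b), (sigma / 8).
split; first by case: c; [exact: expansion_dx | exact: expansion_dy].
by move=> i j /=; rewrite addnS -addSn => ijs; case: c;
  rewrite /dx_coef /dy_coef b0 ?mulr0// addnS.
Qed.

Theorem theorem3p3 (R : realType) (Omega : set (R * R)) (lambda : R)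
  (u : R * R -> R) (x0 : R * R) (h alpha : R) (em ep : R * R) (n : nat) :
  open Omega ->
  0 < lambda ->
  real_analytic_on Omega u ->
  L2_on Omega u ->
  (forall p, Omega p -> - laplacian u p = lambda * u p) ->
  Omega x0 ->
  0 < h ->
  0 < alpha < 1 ->
  (* e^- unit vector, e^+ = e^- rotated by the angle alpha * pi *)
  em.1 ^+ 2 + em.2 ^+ 2 = 1 ->
  ep = (cos (alpha * pi) * em.1 - sin (alpha * pi) * em.2,
        sin (alpha * pi) * em.1 + cos (alpha * pi) * em.2) ->
  segment x0 ep h `<=` Omega ->
  segment x0 em h `<=` Omega ->
  (* Neumann condition on Gamma^+ and Gamma^-, normal nu = (-e.2, e.1) *)
  (forall p, segment x0 ep h p -> - ep.2 * dx u p + ep.1 * dy u p = 0) ->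
  (forall p, segment x0 em h p -> - em.2 * dx u p + em.1 * dy u p = 0) ->
  (3 <= n)%N ->
  u x0 = 0 ->
  (forall p q : nat, (1 <= q)%N -> (q < p)%N -> (p <= n - 1)%N ->
     alpha != q%:R / p%:R) ->
  forall s : seq bool, (size s <= n - 1)%N -> pderiv s u x0 = 0.
Proof.
move=> oO _ uO _ helm Ox0 h0 alpha01 em1 epE _ _ Nep Nem n3 ux0 alpha_irr s sn.
have [a [rho ua]] := expansion_exists _ _ _ uO Ox0.
(* The equation holds on a whole neighbourhood of [x0], so it passes to each coefficient of the
   expansion of [laplacian u + lambda * u]. *)
have lap i j :
    dx_coef (dx_coef a) i j + dy_coef (dy_coef a) i j + lambda * a i j = 0.
  have /nbhs_ballP[d /= d0 dO] : nbhs x0 Omega by exact: open_nbhs_nbhs.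
  apply: (expansion_zero _ _ _ _ d (expansionD _ _ _ _ _ _ _ (expansionD _ _ _ _ _ _ _
    (expansion_dx _ _ _ _ (expansion_dx _ _ _ _ ua))
    (expansion_dy _ _ _ _ (expansion_dy _ _ _ _ ua))) (expansionZ lambda _ _ _ _ ua))) => //.
  move=> x y xd yd; rewrite -helm ?subrr ?addrN//.
  by apply: dO; split; rewrite /ball/= opprD addrA subrr sub0r normrN.
(* Coefficients of the normal derivative of degree below [m] involve [a] only up to degree [m], so
   its term of degree [m] is the lowest one and vanishes along the ray. *)
have ray m e : e.1 ^+ 2 + e.2 ^+ 2 = 1 ->
    (forall p, segment x0 e h p -> - e.2 * dx u p + e.1 * dy u p = 0) ->
    (forall i j, (i + j <= m)%N -> a i j = 0) ->
    \sum_(i < m.+1) normal_coef a e i (m - i) * e.1 ^+ i * e.2 ^+ (m - i) = 0.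
  move=> e1 Ne am.
  have le1 (x y : R) : x ^+ 2 + y ^+ 2 = 1 -> `|x| <= 1.
    by move=> xy; rewrite ler_norml; apply/andP; split; nra.
  apply: (expansion_ray _ _ _ _ h _ _ _ (expansionD _ _ _ _ _ _ _
    (expansionZ (- e.2) _ _ _ _ (expansion_dx _ _ _ _ ua))
    (expansionZ e.1 _ _ _ _ (expansion_dy _ _ _ _ ua)))) => //.
  - move=> i j ij; rewrite /dx_coef /dy_coef !am ?mulr0 ?addr0// ?addnS//.
  - exact: le1 e1.
  - by apply: (le1 _ e.1); rewrite addrC.
  - by move=> t th; apply: Ne; exists t.
have ep1 : ep.1 ^+ 2 + ep.2 ^+ 2 = 1.
  rewrite epE /= -[RHS]mul1r -{1}(cos2Dsin2 (alpha * pi)) -em1; ring.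
(* Induction on the degree, starting from [u x0 = 0]; the step to degree [m.+1] uses the angle
   condition with denominator [m.+1]. *)
have a0 m : (m <= n - 1)%N -> forall i j, (i + j <= m)%N -> a i j = 0.
  elim: m => [_ [|//] [|//] _|m IH mn i j].
    by rewrite -(expansion_center _ _ _ _ ua).
  have am := IH (ltnW mn).
  rewrite leq_eqVlt => /orP[/eqP ij|]; last by rewrite ltnS; exact: am.
  apply: (harmonic_form_eq0 a m em (alpha * pi)) ij => //.
  - apply: sin_natmul_pi_neq0 => // q q1 qm; exact: alpha_irr.
  (* The term [lambda * a i' j'] has degree [m - 1] and is already zero, which leaves the Laplace
     relation for degree [m.+1]. *)
  - move=> i' j' ij'; have := lap i' j'.
    by rewrite (am i' j') ?mulr0 ?addr0// -ij'.
  - exact: ray.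
  - by rewrite -epE; exact: ray.
have nE : (n - 1).+1 = n by rewrite subn1 prednK// (leq_trans _ n3).
have an i j : (i + j < n)%N -> a i j = 0 by rewrite -nE ltnS; exact: a0.
have [b [sigma [sb b0]]] := pderiv_expansion _ _ _ _ n ua an s.
by rewrite (expansion_center _ _ _ _ sb) b0// -nE ltnS.
Qed.
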